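(* For every $n\in\mathbb{N}$, $\Psi_n:\mathcal{PP}(n)\to\mathfrak{S}_n$ is a bijection, of inverse $\Phi_n:\mathfrak{S}_n\to\mathcal{PP}(n)$. As a consequence, $\mathrm{card}(\mathcal{PP}(n))=n!$ for all $n\in\mathbb{N}$.
   Context: A plane poset is a finite set $P$ with two partial orders $\leq_h,\leq_r$ such that, for all $x\neq y$ in $P$, $x$ and $y$ are comparable for $\leq_h$ if and only if they are not comparable for $\leq_r$. $\mathcal{PP}(n)$ is the set of isoclasses of plane posets with $n$ elements. The relation $x\leq y$ iff ($x\leq_h y$ or $x\leq_r y$) is a total order on $P$ (the induced total order); up to a unique increasing bijection, we suppose that $P=\{1,\ldots,n\}$ as a totally ordered set. Any subset of a plane poset is a plane poset by restriction. $\Phi_n(\sigma)$ is the plane poset $(\{1,\ldots,n\},\leq_h,\leq_r)$ where $i\leq_h j$ iff ($i\leq j$ and $\sigma(i)\leq\sigma(j)$), and $i\leq_r j$ iff ($i\leq j$ and $\sigma(i)\geq\sigma(j)$). For a nonempty plane poset $P$, put $\kappa(P)=\max\{y\in P\mid \forall x\in P,\ x\leq y\Rightarrow x\leq_h y\}$ (maximum for the induced total order). For $P\in\mathcal{PP}(n)$ with $P=\{1,\ldots,n\}$, $\Psi_n(P)$ is the permutation $\sigma\in\mathfrak{S}_n$ defined inductively by $\sigma^{-1}(n)=\kappa(P)$ and $\sigma^{-1}(m)=\kappa\left(P\setminus\{\sigma^{-1}(n),\ldots,\sigma^{-1}(m+1)\}\right)$ for $m=n-1,\ldots,1$. *)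

(* Defs.v *)
From HB Require Import structures.
From mathcomp Require Import all_boot all_fingroup.

Set Implicit Arguments.
Unset Strict Implicit.
Unset Printing Implicit Defensive.

(* Binary relations on a finite type are encoded by their graphs, so that the
   plane poset structures on a given finite type themselves form a finite type. *)

Definition partial_order (T : finType) (R : {set T * T}) : bool :=
  [&& [forall x, (x, x) \in R],
      [forall x, forall y, ((x, y) \in R) && ((y, x) \in R) ==> (x == y)]
    & [forall x, forall y, forall z,
         ((x, y) \in R) && ((y, z) \in R) ==> ((x, z) \in R)]].

Definition comparable (T : finType) (R : {set T * T}) (x y : T) : bool :=
  ((x, y) \in R) || ((y, x) \in R).

Definition is_plane_poset (T : finType) (hr : {set T * T} * {set T * T}) : bool :=
  [&& partial_order hr.1, partial_order hr.2
    & [forall x, forall y,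
         (x != y) ==> (comparable hr.1 x y == ~~ comparable hr.2 x y)]].

Record planePoset (T : finType) := PlanePoset {
  pp_rels : {set T * T} * {set T * T};
  _ : is_plane_poset pp_rels }.

HB.instance Definition _ (T : finType) := [isSub for @pp_rels T].
HB.instance Definition _ (T : finType) := [Finite of planePoset T by <:].

Section PlanePosets.
Variable T : finType.
Implicit Types (P : planePoset T) (A : {set T}).

Definition hle P (x y : T) : bool := (x, y) \in (pp_rels P).1.
Definition rle P (x y : T) : bool := (x, y) \in (pp_rels P).2.

Definition tle P (x y : T) : bool := hle P x y || rle P x y.

Definition kappa_cand P A (y : T) : bool :=
  (y \in A) && [forall x in A, tle P x y ==> hle P x y].

(* [kappa P A] is kappa of the plane poset induced by P on the subset A; it is
   [None] only for empty A, see [kappa_neq0]. *)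
Definition kappa P A : option T :=
  [pick y | kappa_cand P A y && [forall z, kappa_cand P A z ==> tle P z y]].

(* What is left of P after k successive removals of kappa. *)
Fixpoint rest P (k : nat) : {set T} :=
  if k is k'.+1 then [set x in rest P k' | Some x != kappa P (rest P k')]
  else [set: T].

(* The unique increasing bijection from T onto {0, ..., #|T| - 1}. *)
Definition rank P (x : T) : nat := #|[set y | tle P y x && (y != x)]|.

Lemma pporderP P :
  (partial_order (pp_rels P).1 * partial_order (pp_rels P).2)%type.
Proof. by case: P => hr /= /and3P[]. Qed.

Lemma porderP (R : {set T * T}) : partial_order R ->
  [/\ forall x, (x, x) \in R,
      forall x y, (x, y) \in R -> (y, x) \in R -> x = y
    & forall y x z, (x, y) \in R -> (y, z) \in R -> (x, z) \in R].
Proof.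
case/and3P=> /forallP Rxx /forallP Ras /forallP Rtr; split=> //.
  by move=> x y Rxy Ryx; move/forallP/(_ y): (Ras x); rewrite Rxy Ryx => /eqP.
move=> y x z Rxy Ryz; move/forallP/(_ y)/forallP/(_ z): (Rtr x).
by rewrite Rxy Ryz.
Qed.

Lemma hle_refl P x : hle P x x.
Proof. by have [h _ _] := porderP (pporderP P).1; apply: h. Qed.
Lemma rle_refl P x : rle P x x.
Proof. by have [h _ _] := porderP (pporderP P).2; apply: h. Qed.
Lemma hle_anti P x y : hle P x y -> hle P y x -> x = y.
Proof. by have [_ h _] := porderP (pporderP P).1; apply: h. Qed.
Lemma rle_anti P x y : rle P x y -> rle P y x -> x = y.
Proof. by have [_ h _] := porderP (pporderP P).2; apply: h. Qed.
Lemma hle_trans P y x z : hle P x y -> hle P y z -> hle P x z.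
Proof. by have [_ _ h] := porderP (pporderP P).1; apply: h. Qed.
Lemma rle_trans P y x z : rle P x y -> rle P y z -> rle P x z.
Proof. by have [_ _ h] := porderP (pporderP P).2; apply: h. Qed.

Lemma hr_comparable P x y : x != y ->
  (hle P x y || hle P y x) = ~~ (rle P x y || rle P y x).
Proof.
case: P => hr H nxy; rewrite /hle /rle /=.
by case/and3P: (H) => _ _ /forallP/(_ x)/forallP/(_ y); rewrite nxy => /eqP.
Qed.

Lemma tle_refl P x : tle P x x.
Proof. by rewrite /tle hle_refl. Qed.

Lemma tle_total P x y : tle P x y || tle P y x.
Proof.
have [->|/(hr_comparable P)] := eqVneq x y; first by rewrite tle_refl.
by rewrite /tle; do 4!case: (_ P _ _).
Qed.

Lemma tle_anti P x y : tle P x y -> tle P y x -> x = y.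
Proof.
have [//|/(hr_comparable P)] := eqVneq x y.
rewrite /tle => e /orP[] xy /orP[] yx.
- exact: hle_anti xy yx.
- by move: e; rewrite xy yx orbT.
- by move: e; rewrite xy yx orbT.
- exact: rle_anti xy yx.
Qed.

Lemma tle_trans P y x z : tle P x y -> tle P y z -> tle P x z.
Proof.
have [->//|nxy] := eqVneq x y; have [->//|nyz] := eqVneq y z.
have [->|nxz] := eqVneq x z; first by rewrite tle_refl.
have e1 := hr_comparable P nxy; have e2 := hr_comparable P nyz.
have e3 := hr_comparable P nxz.
have := @hle_trans P y x z; have := @rle_trans P y x z.
have := @hle_trans P x z y; have := @rle_trans P x z y.
have := @hle_trans P z y x; have := @rle_trans P z y x.
move: e1 e2 e3; rewrite /tle.
case: (hle P x y); case: (rle P x y); case: (hle P y x); case: (rle P y x);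
case: (hle P y z); case: (rle P y z); case: (hle P z y); case: (rle P z y);
case: (hle P x z); case: (rle P x z); case: (hle P z x); case: (rle P z x);
  rewrite //=; intuition.
Qed.

Lemma rank_lt P x : rank P x < #|T|.
Proof.
rewrite /rank -cardsT; apply: proper_card; apply/properP.
by split; [apply: subsetT | exists x; rewrite ?inE // eqxx andbF].
Qed.

Lemma ltn_rank P x y : tle P x y -> x != y -> rank P x < rank P y.
Proof.
move=> xy nxy; apply: proper_card; apply/properP; split.
  apply/subsetP=> z; rewrite !inE => /andP[zx nzx].
  rewrite (tle_trans zx xy); apply: contra nzx => /eqP zy.
  by rewrite zy in zx *; rewrite (tle_anti xy zx).
by exists x; rewrite !inE ?xy ?nxy // eqxx andbF.
Qed.

Lemma rank_inj P : injective (rank P).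
Proof.
move=> x y e; apply/eqP/negPn/negP=> nxy.
case/orP: (tle_total P x y) => xy; first by have := ltn_rank xy nxy; rewrite e ltnn.
by rewrite eq_sym in nxy; have := ltn_rank xy nxy; rewrite e ltnn.
Qed.

Lemma leq_rank P x y : (rank P x <= rank P y) = tle P x y.
Proof.
have [->|nxy] := eqVneq x y; first by rewrite tle_refl leqnn.
case/orP: (tle_total P x y) => xy; first by rewrite xy (ltnW (ltn_rank xy nxy)).
rewrite leqNgt ltn_rank 1?eq_sym //=; apply/esym/negP=> yx.
by rewrite (tle_anti yx xy) eqxx in nxy.
Qed.

Lemma kappa_neq0 P A : A != set0 -> exists2 y, kappa P A = Some y & y \in A.
Proof.
case/set0Pn=> x0 Ax0; rewrite /kappa; case: pickP => [y /andP[/andP[Ay _] _]|no].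
  by exists y.
have [m Am minm] := arg_minnP (rank P) Ax0.
have cm : kappa_cand P A m.
  rewrite /kappa_cand [m \in A]Am; apply/forallP=> x; apply/implyP=> Ax; apply/implyP=> xm.
  have mx : tle P m x by rewrite -leq_rank minm.
  by rewrite (tle_anti xm mx) hle_refl.
have [y cy maxy] := arg_maxnP (rank P) cm.
have := no y; rewrite [kappa_cand _ _ y]cy /= => /negP[].
by apply/forallP=> z; apply/implyP=> cz; rewrite -leq_rank; apply: maxy.
Qed.

Lemma card_rest P k : #|rest P k| = #|T| - k.
Proof.
elim: k => [|k IH] /=; first by rewrite cardsT subn0.
have [r0|/(kappa_neq0 P)[y ky ry]] := eqVneq (rest P k) set0.
  rewrite (_ : [set _ in _ | _] = set0) ?cards0; last first.
    by apply/setP=> x; rewrite r0 !inE.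
  by move: IH; rewrite r0 cards0 subnS => <-.
rewrite (_ : [set _ in _ | _] = rest P k :\ y); last first.
  by apply/setP=> x; rewrite ky !inE andbC; congr (~~ _ && _).
by rewrite subnS -IH (cardsD1 y (rest P k)) ry.
Qed.

Lemma subset_rest P i j : i <= j -> rest P j \subset rest P i.
Proof.
move/subnK <-; elim: (j - i) => [|k IH] //=.
by apply: subset_trans IH; apply/subsetP=> x; rewrite inE => /andP[].
Qed.

Lemma kappa_rest P k : k < #|T| ->
  exists y, [/\ kappa P (rest P k) = Some y, y \in rest P k & y \notin rest P k.+1].
Proof.
move=> lk; have [|y ky ry] := @kappa_neq0 P (rest P k).
  by rewrite -card_gt0 card_rest subn_gt0.
by exists y; split; rewrite //= inE ky eqxx andbF.
Qed.

End PlanePosets.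

Definition is_iso (T U : finType) (P : planePoset T) (Q : planePoset U) (f : T -> U) :=
  [&& [forall y, y \in codom f], injectiveb f
    & [forall x, forall y,
         (hle Q (f x) (f y) == hle P x y) && (rle Q (f x) (f y) == rle P x y)]].

Definition pp_iso (T U : finType) (P : planePoset T) (Q : planePoset U) : bool :=
  [exists f : {ffun T -> U}, is_iso P Q f].

Lemma is_isoP (T U : finType) (P : planePoset T) (Q : planePoset U) (f : T -> U) :
  reflect [/\ bijective f, forall x y, hle Q (f x) (f y) = hle P x y
            & forall x y, rle Q (f x) (f y) = rle P x y] (is_iso P Q f).
Proof.
apply: (iffP and3P) => [[/forallP sf /injectiveP injf /forallP H]|[bf hf rf]].
  split.
  - exists (fun y => iinv (sf y)) => [x|y]; last exact: f_iinv.
    by apply: injf; rewrite f_iinv.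
  - by move=> x y; move/forallP/(_ y)/andP: (H x) => [/eqP].
  - by move=> x y; move/forallP/(_ y)/andP: (H x) => [_ /eqP].
split; last by apply/forallP=> x; apply/forallP=> y; rewrite hf rf !eqxx.
- by case: bf => g _ gK; apply/forallP=> y; rewrite -(gK y) codom_f.
- exact/injectiveP/bij_inj.
Qed.

Lemma pp_isoP (T U : finType) (P : planePoset T) (Q : planePoset U) :
  reflect (exists f : T -> U,
             [/\ bijective f, forall x y, hle Q (f x) (f y) = hle P x y
               & forall x y, rle Q (f x) (f y) = rle P x y]) (pp_iso P Q).
Proof.
apply: (iffP existsP) => [[f /is_isoP]|[f [bf hf rf]]]; first by exists f.
exists [ffun x => f x]; apply/is_isoP; split.
- by apply: eq_bij bf _ _ => x; rewrite ffunE.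
- by move=> x y; rewrite !ffunE.
- by move=> x y; rewrite !ffunE.
Qed.

Lemma pp_iso_refl (T : finType) : reflexive (@pp_iso T T).
Proof. by move=> P; apply/pp_isoP; exists id; split=> //; exists id. Qed.

Lemma pp_isoW (T U : finType) (P : planePoset T) (Q : planePoset U) :
  pp_iso P Q -> pp_iso Q P.
Proof.
case/pp_isoP=> f [[g fK gK] hf rf]; apply/pp_isoP; exists g.
by split=> [|x y|x y]; [exists f | rewrite -hf !gK | rewrite -rf !gK].
Qed.

Lemma pp_iso_sym (T : finType) : symmetric (@pp_iso T T).
Proof. by move=> P Q; apply/idP/idP; apply: pp_isoW. Qed.

Lemma pp_iso_trans (T U V : finType) (P : planePoset T) (Q : planePoset U)
  (W : planePoset V) : pp_iso P Q -> pp_iso Q W -> pp_iso P W.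
Proof.
case/pp_isoP=> f [bf hf rf] /pp_isoP[g [bg hg rg]]; apply/pp_isoP.
exists (g \o f); split=> [|x y|x y] /=; first exact: bij_comp.
  by rewrite hg hf.
by rewrite rg rf.
Qed.

Canonical pp_iso_equiv (n : nat) :=
  EquivRel (@pp_iso 'I_n 'I_n) (@pp_iso_refl 'I_n) (@pp_iso_sym 'I_n)
    (fun Q P R => @pp_iso_trans _ _ _ P Q R).

(* Isoclasses of plane posets with n elements. The carrier 'I_n is no
   restriction, see [pp_iso_ord]; its usual order plays no role here. *)
Definition PP (n : nat) := {eq_quot (@pp_iso_equiv n)}%qT.
HB.instance Definition _ n := Choice.on (PP n).
HB.instance Definition _ n := EqQuotient.on (PP n).
HB.instance Definition _ n : isCountable (PP n) := CanIsCountable (@reprK _ (PP n)).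
HB.instance Definition _ n : isFinite (PP n) := CanIsFinite (@reprK _ (PP n)).

Lemma pp_iso_ord (T : finType) (P : planePoset T) :
  exists Q : planePoset 'I_#|T|, pp_iso P Q.
Proof.
pose tr (R : {set T * T}) : {set 'I_#|T| * 'I_#|T|} :=
  [set ij | (enum_val ij.1, enum_val ij.2) \in R].
have trP R : partial_order R -> partial_order (tr R).
  case/porderP=> Rxx Ras Rtr; apply/and3P; split.
  - by apply/forallP=> i; rewrite inE Rxx.
  - apply/forallP=> i; apply/forallP=> j; rewrite !inE /=.
    by apply/implyP=> /andP[ij ji]; apply/eqP/enum_val_inj/Ras.
  - apply/forallP=> i; apply/forallP=> j; apply/forallP=> k; rewrite !inE /=.
    by apply/implyP=> /andP[ij jk]; apply: Rtr ij jk.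
have H : is_plane_poset (tr (pp_rels P).1, tr (pp_rels P).2).
  apply/and3P; split; [exact: trP (pporderP P).1 | exact: trP (pporderP P).2 |].
  apply/forallP=> i; apply/forallP=> j; apply/implyP=> nij.
  rewrite /comparable !inE /= -!/(hle _ _ _) -!/(rle _ _ _) hr_comparable //.
  by apply: contra nij => /eqP/enum_val_inj->.
exists (PlanePoset H); apply/pp_isoP; exists enum_rank; split.
- by exists enum_val; [apply: enum_rankK | apply: enum_valK].
- by move=> x y; rewrite {1}/hle inE /= !enum_rankK.
- by move=> x y; rewrite {1}/rle inE /= !enum_rankK.
Qed.

Section Psi.
Variables (n : nat).
Implicit Type P : planePoset 'I_n.

(* Indices are shifted by one: m : 'I_n stands for m + 1 in {1, ..., n}, so that
   sigma^-1(m + 1) is the rank of the element chosen after n - m - 1 removals. *)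
Definition psi_inv_fun P (m : 'I_n) : nat :=
  rank P (odflt m (kappa P (rest P (rev_ord m)))).

Lemma psi_inv_fun_lt P m : psi_inv_fun P m < n.
Proof. by have := rank_lt P (odflt m (kappa P (rest P (rev_ord m)))); rewrite card_ord. Qed.

Definition psi_inv_ord P (m : 'I_n) : 'I_n := Ordinal (psi_inv_fun_lt P m).

Lemma psi_inv_ord_inj P : injective (psi_inv_ord P).
Proof.
suff H (a b : 'I_n) : rev_ord a < rev_ord b -> psi_inv_fun P a <> psi_inv_fun P b.
  move=> a b /(congr1 val) /= e; apply: rev_ord_inj; apply: val_inj; apply/eqP.
  by case: ltngtP => // /H; rewrite e.
have ltT (c : 'I_n) : rev_ord c < #|{: 'I_n}| by rewrite card_ord.
move=> ab; rewrite /psi_inv_fun.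
have [y [-> _ nry]] := kappa_rest P (ltT a).
have [z [-> rz _]] := kappa_rest P (ltT b).
move=> /rank_inj /= yz; move/negP: nry; apply.
by rewrite yz; apply: (subsetP (subset_rest P ab)).
Qed.

Definition psi P : 'S_n := ((perm (@psi_inv_ord_inj P))^-1)%g.

Lemma psi_iso P Q : pp_iso P Q -> psi P = psi Q.
Proof.
case/pp_isoP=> f [bf hf rf]; have injf := bij_inj bf.
have tf x y : tle Q (f x) (f y) = tle P x y by rewrite /tle hf rf.
have imf (A : {set 'I_n}) x : (f x \in f @: A) = (x \in A) by rewrite mem_imset.
have candf (A : {set 'I_n}) x : kappa_cand Q (f @: A) (f x) = kappa_cand P A x.
  rewrite /kappa_cand imf; congr (_ && _); apply/forall_inP/forall_inP=> H y.
    by move=> Ay; rewrite -tf -hf; apply: H; rewrite imf.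
  by case/imsetP=> z Az ->; rewrite tf hf; apply: H.
have maxf (A : {set 'I_n}) x : [forall z, kappa_cand Q (f @: A) z ==> tle Q z (f x)]
             = [forall z, kappa_cand P A z ==> tle P z x].
  apply/forallP/forallP=> H z; first by rewrite -(candf A) -tf.
  by case: bf => g _ gK; rewrite -(gK z) candf tf.
have kf (A : {set 'I_n}) : kappa Q (f @: A) = omap f (kappa P A).
  rewrite /kappa; case: pickP => [z|no]; case: pickP => [x /andP[cx mx]|no'] //=.
  - case: bf => g _ gK; rewrite -(gK z) candf maxf => /andP[cz mz].
    congr (Some (f _)); apply: (@tle_anti _ P).
      by move/forallP/(_ (g z)): mx; rewrite cz.
    by move/forallP/(_ x): mz; rewrite cx.
  - by case: bf => g _ gK; rewrite -(gK z) candf maxf no'.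
  - by have := no (f x); rewrite candf maxf cx mx.
have restf k : rest Q k = f @: rest P k.
  elim: k => [|k IH] /=.
    apply/setP=> y; case: bf => g _ gK.
    by rewrite -(gK y) imf !inE.
  apply/setP=> y; case: bf => g _ gK.
  rewrite -(gK y) imf !inE IH imf kf; congr (_ && ~~ _).
  by case: (kappa P _) => [z|] //=; apply/eqP/eqP=> [[/injf->]|[->]].
have rankf x : rank Q (f x) = rank P x.
  rewrite /rank -[RHS](card_imset _ injf); apply: eq_card => y.
  case: bf => g _ gK; rewrite -(gK y) imf !inE tf; congr (_ && ~~ _).
  by apply/eqP/eqP=> [/injf|->].
congr (_^-1)%g; apply/permP=> m; rewrite !permE; apply: val_inj.
rewrite /= /psi_inv_fun restf kf.
have ltm : rev_ord m < #|{: 'I_n}| by rewrite card_ord.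
by have [y [-> _ _]] := kappa_rest P ltm; rewrite /= rankf.
Qed.

Definition Psi (C : PP n) : 'S_n := psi (generic_quotient.repr C).

Lemma Psi_pi P : Psi (\pi_(PP n)%qT P) = psi P.
Proof. by apply: psi_iso; apply/eqmodP; rewrite reprK. Qed.

Definition phi_rels (s : 'S_n) : {set 'I_n * 'I_n} * {set 'I_n * 'I_n} :=
  ([set ij : 'I_n * 'I_n | (ij.1 <= ij.2) && (s ij.1 <= s ij.2)],
   [set ij : 'I_n * 'I_n | (ij.1 <= ij.2) && (s ij.1 >= s ij.2)]).

Lemma phi_subproof (s : 'S_n) : is_plane_poset (phi_rels s).
Proof.
apply/and3P; split=> /=.
- apply/and3P; split.
  + by apply/forallP=> i; rewrite inE /= !leqnn.
  + apply/forallP=> i; apply/forallP=> j; rewrite !inE /=; apply/implyP.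
    by case/andP=> /andP[ij _] /andP[ji _]; apply/eqP/val_inj/anti_leq/andP.
  + apply/forallP=> i; apply/forallP=> j; apply/forallP=> k; rewrite !inE /=.
    apply/implyP=> /andP[/andP[ij sij] /andP[jk sjk]].
    by rewrite (leq_trans ij jk) (leq_trans sij sjk).
- apply/and3P; split.
  + by apply/forallP=> i; rewrite inE /= !leqnn.
  + apply/forallP=> i; apply/forallP=> j; rewrite !inE /=; apply/implyP.
    by case/andP=> /andP[ij _] /andP[ji _]; apply/eqP/val_inj/anti_leq/andP.
  + apply/forallP=> i; apply/forallP=> j; apply/forallP=> k; rewrite !inE /=.
    apply/implyP=> /andP[/andP[ij sij] /andP[jk sjk]].
    by rewrite (leq_trans ij jk) (leq_trans sjk sij).
- apply/forallP=> i; apply/forallP=> j; apply/implyP=> nij.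
  have nsij : s i != s j by apply: contra nij => /eqP/perm_inj->.
  rewrite /comparable !inE /=; move: nij nsij; rewrite -!val_eqE /=.
  by case: (ltngtP i j); case: (ltngtP (s i) (s j)).
Qed.

Definition phi (s : 'S_n) : planePoset 'I_n := PlanePoset (phi_subproof s).

Definition Phi (s : 'S_n) : PP n := \pi_(PP n)%qT (phi s).

End Psi.

(* Main.v *)
Require Import Defs.
From mathcomp Require Import all_boot all_order all_fingroup.

Set Implicit Arguments.
Unset Strict Implicit.
Unset Printing Implicit Defensive.

(** The total order of a plane poset and its order [hle] determine [rle], so a
    plane poset structure is encoded by the ranks of its elements together with
    the set of the pairs at which [hle] holds. The permutation [psi P] records
    the order in which the elements are removed by iterating [kappa], the last
    value being given to the element removed first. The point is that removal
    times see [hle]: when [y] is removed while [x] is still present, [x] below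
    [y] implies [hle P x y], by definition of [kappa] ([kappa_hle]), while
    [hle P y x] is impossible ([kappa_hmax]). Hence, for [x] below [y], the
    relation [hle P x y] holds exactly when [y] is removed before [x], i.e. when
    the permutation increases from [x] to [y]: the rank is an isomorphism from
    [P] onto [phi (psi P)] ([phi_psi_iso]).

    The converse needs no computation of [kappa]. An isomorphism from [phi s] to
    [phi t] is increasing on an initial segment of the integers, hence is the
    identity, so [s] and [t] have the same inversions and are equal
    ([phi_iso_inj]). Thus [Phi] is injective, and its right inverse [Psi] is also
    a left inverse. *)

Section KappaProperties.
Variables (T : finType) (P : planePoset T).
Implicit Types (A : {set T}) (x y z : T).

Lemma hle_tle x y : hle P x y -> tle P x y.
Proof. by rewrite /tle => ->. Qed.

Lemma rleE x y : x != y -> rle P x y = tle P x y && ~~ hle P x y.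
Proof.
move=> /(hr_comparable P); rewrite /tle.
by do 4!case: (_ P _ _).
Qed.

Lemma kappaP A y : kappa P A = Some y ->
  [/\ y \in A, {in A, forall x, tle P x y -> hle P x y}
    & forall z, kappa_cand P A z -> tle P z y].
Proof.
rewrite /kappa; case: pickP => [z /andP[/andP[Az /forall_inP cz] /forall_inP mz]|//].
by case=> <-; split=> // x Ax; apply/implyP/cz.
Qed.

Lemma kappa_hle A x y : kappa P A = Some y -> x \in A -> hle P x y = tle P x y.
Proof.
case/kappaP=> _ cy _ Ax; apply/idP/idP; [exact: hle_tle | exact: cy].
Qed.

(** If some elements of [A] were strictly above [kappa P A] for [hle], the least
    of them for the total order would satisfy the condition that defines
    [kappa], against the maximality of [kappa P A]. *)
Lemma kappa_hmax A x y : kappa P A = Some x -> y \in A -> hle P x y -> y = x.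
Proof.
case/kappaP=> Ax cx maxx Ay xy; apply/eqP/negPn/negP=> nyx.
pose above z := [&& z \in A, hle P x z & z != x].
have Qy : above y by apply/and3P.
have [m /and3P[Am xm nmx] minm] := arg_minnP (rank P) Qy.
case/eqP: nmx; apply: (@tle_anti _ P); last exact: hle_tle.
apply: maxx; rewrite /kappa_cand [m \in A]Am.
apply/forall_inP=> z Az; apply/implyP=> zm.
have [->|nzm] := eqVneq z m; first exact: hle_refl.
apply/negPn/negP=> nhzm; have rzm : rle P z m by rewrite rleE // zm.
(* Below x, the element z is also below m for hle. *)
have [/(cx z Az) hzx|nzx] := boolP (tle P z x).
  by case/negP: nhzm; apply: hle_trans hzx xm.
have xz : tle P x z by have := tle_total P x z; rewrite (negPf nzx) orbF.
have nxz : z != x by apply: contraNneq nzx => ->; rewrite tle_refl.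
(* Above x, z would be a smaller element than m that is hle-above x. *)
have hxz : hle P x z.
  apply/negPn/negP=> nhxz.
  have rxz : rle P x z by rewrite rleE 1?eq_sym // xz.
  have := rle_trans rxz rzm; rewrite rleE ?xm ?andbF //.
  by apply: contraNneq nzx => ->.
have := minm z; rewrite /above [z \in A]Az hxz nxz leq_rank => /(_ isT) mz.
by case/eqP: nzm; apply: (tle_anti zm mz).
Qed.

End KappaProperties.

(** An injection that respects the total order and [hle] respects [rle]. *)
Lemma rle_mono (T U : finType) (P : planePoset T) (Q : planePoset U) (f : T -> U) :
    injective f -> {mono f : x y / tle P x y >-> tle Q x y} ->
    {mono f : x y / hle P x y >-> hle Q x y} ->
  {mono f : x y / rle P x y >-> rle Q x y}.
Proof.
move=> injf tf hf x y; have [->|nxy] := eqVneq x y; first by rewrite !rle_refl.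
by rewrite !rleE ?inj_eq // tf hf.
Qed.

Section PhiPsi.
Variable n : nat.
Implicit Types (P : planePoset 'I_n) (s t : 'S_n).

Lemma hle_phi s (i j : 'I_n) : hle (phi s) i j = (i <= j) && (s i <= s j).
Proof. by rewrite /hle inE. Qed.

Lemma tle_phi s (i j : 'I_n) : tle (phi s) i j = (i <= j).
Proof. by rewrite /tle /hle /rle !inE -andb_orr leq_total andbT. Qed.

Lemma rank_ltn P x : rank P x < n.
Proof. by rewrite -[ltnRHS]card_ord rank_lt. Qed.

Definition rank_ord P x : 'I_n := Ordinal (rank_ltn P x).

Lemma rank_ord_inj P : injective (rank_ord P).
Proof. by move=> x y /(congr1 val)/rank_inj. Qed.

(** This is how [psi P] is used: as a clock of removals, running backwards since
    the greatest value goes to the element removed first. *)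
Lemma kappa_rest_psi P x :
  kappa P (rest P (rev_ord (psi P (rank_ord P x)))) = Some x.
Proof.
set m := psi P _.
have ltm : rev_ord m < #|{: 'I_n}| by rewrite card_ord.
have [y [ky _ _]] := kappa_rest P ltm; rewrite ky; congr Some.
apply: (@rank_inj _ P); have := permK (psi P) (rank_ord P x).
by rewrite -/m invgK permE => /(congr1 val) /=; rewrite /psi_inv_fun ky.
Qed.

(** An element with a smaller value is removed later, so it is still present. *)
Lemma mem_rest_psi P x y :
  psi P (rank_ord P x) <= psi P (rank_ord P y) ->
  x \in rest P (rev_ord (psi P (rank_ord P y))).
Proof.
move=> le_xy; have [x_in _ _] := kappaP (kappa_rest_psi P x).
by apply: subsetP x_in; apply: subset_rest; rewrite leq_sub2l.
Qed.

Lemma phi_psi_iso P : pp_iso P (phi (psi P)).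
Proof.
have tr : {mono rank_ord P : x y / tle P x y >-> tle (phi (psi P)) x y}.
  by move=> x y; rewrite tle_phi leq_rank.
have hr : {mono rank_ord P : x y / hle P x y >-> hle (phi (psi P)) x y}.
  move=> x y; rewrite hle_phi /= leq_rank.
  have [le_xy|lt_yx] := leqP.
    by rewrite andbT (kappa_hle (kappa_rest_psi P y)) ?mem_rest_psi.
  rewrite andbF; apply/esym/negP=> hxy.
  have yx := kappa_hmax (kappa_rest_psi P x) (mem_rest_psi (ltnW lt_yx)) hxy.
  by rewrite yx ltnn in lt_yx.
apply/pp_isoP; exists (rank_ord P); split=> //.
- exact/injF_bij/rank_ord_inj.
- exact: rle_mono (@rank_ord_inj P) tr hr.
Qed.

Lemma mono_ord_id (f : 'I_n -> 'I_n) : {mono f : i j / i <= j} -> f =1 id.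
Proof. by move=> mf; apply: Order.mono_unique => //; apply: leq_total. Qed.

Lemma phi_iso_inj s t : pp_iso (phi s) (phi t) -> s = t.
Proof.
case/pp_isoP=> f [_ hf rf].
have fid : f =1 id.
  by apply: mono_ord_id => i j; rewrite -(tle_phi t) -(tle_phi s) /tle hf rf.
have st : {mono (s^-1 * t)%g : i j / i <= j}.
  move=> i j; rewrite !permM.
  (* Both permutations have the inversions that hle records. *)
  suff H x y : (t x <= t y) = (s x <= s y) by rewrite H !permKV.
  wlog le_xy : x y / x <= y => [H|].
    have [/H//|lt_yx] := leqP x y.
    have nyx : y != x by rewrite neq_ltn lt_yx.
    have ne (r : 'S_n) : nat_of_ord (r y) != r x.
      by apply: contra nyx => /eqP/val_inj/perm_inj->.
    by rewrite leqNgt [RHS]leqNgt !ltn_neqAle !ne H // ltnW.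
  by have := hf x y; rewrite !fid !hle_phi le_xy.
apply/permP=> i; have := mono_ord_id st (s i).
by rewrite permM permK => ->.
Qed.

Lemma PsiK : cancel (@Psi n) (@Phi n).
Proof.
move=> C; rewrite -[RHS]reprK; apply/eqmodP.
by rewrite /= pp_iso_sym; apply: phi_psi_iso.
Qed.

Lemma Phi_inj : injective (@Phi n).
Proof. by move=> s t /eqmodP/phi_iso_inj. Qed.

End PhiPsi.

Theorem proposition3p6 (n : nat) :
  bijective (@Psi n)
  /\ (cancel (@Psi n) (@Phi n) /\ cancel (@Phi n) (@Psi n))
  /\ #|{: PP n}| = n`!.
Proof.
have PhiK : cancel (@Phi n) (@Psi n) by apply: inj_can_sym (@PsiK n) (@Phi_inj n).
have bijPsi : bijective (@Psi n) by exists (@Phi n); first exact: PsiK.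
split=> //; split; first by split; first exact: PsiK.
by rewrite (bij_eq_card bijPsi) card_Sn.
Qed.
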